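(* Assume that the KKT solution set $\Omega^*$ is nonempty and that $\mathcal P_f\succeq0$, $\mathcal P_g\succeq0$, $\mathcal P_f+\sigma A^*A\succ0$, $\mathcal P_g+\sigma B^*B\succ0$. Let $\beta\in(0,1]$ be such that for every $w_1,w_2\in\mathbb H$, with $\Delta w:=w_1-w_2$ and $\Delta\mathcal F_{sm}:=\mathcal F_{sm}(w_1)-\mathcal F_{sm}(w_2)$, $$\Delta\mathcal F_{sm}\in\operatorname{Im}(\mathcal M)\qquad\text{and}\qquad\langle\Delta\mathcal F_{sm},\Delta w\rangle\ge\frac1{2\beta}\|\Delta\mathcal F_{sm}\|_{\mathcal M^\dagger}^2 ,$$ and let $0<\rho\le2-\beta$. Let $\{w^k\}$ be generated from $w^0\in\mathbb H$ by the Halpern-accelerated majorized ADMM described in the context, and define the intermediate iterate $u^k:=\mathbf T(w^k)=\widetilde w^{k+1}$ for $k\ge0$. Then there exists $r^k\in\mathcal R(u^k)$ such that $$\|r^k\|\le(1+2\beta)\|\mathcal M\|^{1/2}\|w^k-\mathbf T(w^k)\|_{\mathcal M}.$$ Moreover, for every $w^*\in\Omega^*$, $$\operatorname{dist}(0,\mathcal R(u^k))\le\frac{2(1+2\beta)\|\mathcal M\|^{1/2}}{\rho(k+1)}\|w^0-w^*\|_{\mathcal M}.$$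
   Context: **Setting.** $\mathbb X,\mathbb Y,\mathbb Z$ are finite-dimensional Euclidean spaces, each with an inner product $\langle\cdot,\cdot\rangle$ and induced norm $\|\cdot\|$; $\mathbb H:=\mathbb Y\times\mathbb Z\times\mathbb X$ carries the product inner product and norm, with elements $w=(y,z,x)$. $p:\mathbb Y\to(-\infty,+\infty]$ and $q:\mathbb Z\to(-\infty,+\infty]$ are closed proper convex; $f:\mathbb Y\to\mathbb R$ and $g:\mathbb Z\to\mathbb R$ are convex and differentiable with Lipschitz continuous gradients; $A:\mathbb Y\to\mathbb X$, $B:\mathbb Z\to\mathbb X$ are linear with adjoints $A^*,B^*$; $c\in\mathbb X$. The problem is $\min_{y,z}\ p(y)+f(y)+q(z)+g(z)$ subject to $Ay+Bz=c$. For a self-adjoint linear operator $\Sigma$ (possibly indefinite), $\|v\|_\Sigma^2:=\langle v,\Sigma v\rangle$; $\Sigma\succeq0$ (resp. $\succ0$) means positive semidefinite (resp. definite); $\operatorname{Im}(\Sigma)$ is the range, $\Sigma^\dagger$ the Moore--Penrose pseudoinverse, and $\|\Sigma\|$ the operator norm. $\operatorname{dist}(0,C)=\inf_{r\in C}\|r\|$. **Majorization.** $\widehat\Sigma_f$ on $\mathbb Y$ and $\widehat\Sigma_g$ on $\mathbb Z$ are self-adjoint positive semidefinite linear operators such that, with $\hat f(y,y'):=f(y')+\langle\nabla f(y'),y-y'\rangle+\tfrac12\|y-y'\|_{\widehat\Sigma_f}^2$ and $\hat g(z,z'):=g(z')+\langle\nabla g(z'),z-z'\rangle+\tfrac12\|z-z'\|_{\widehat\Sigma_g}^2$,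 one has $f(y)\le\hat f(y,y')$ and $g(z)\le\hat g(z,z')$ for all $y,y'\in\mathbb Y$, $z,z'\in\mathbb Z$. Let $\sigma>0$, let $\mathcal S$ on $\mathbb Y$ and $\mathcal T$ on $\mathbb Z$ be self-adjoint linear operators (not necessarily semidefinite), and set $\mathcal P_f:=\mathcal S+\widehat\Sigma_f$, $\mathcal P_g:=\mathcal T+\widehat\Sigma_g$. **Operators on $\mathbb H$.** With $\partial$ the convex subdifferential, $$\mathcal R_{ns}(w)=\begin{pmatrix}\partial p(y)+A^*x\\ \partial q(z)+B^*x\\ -Ay-Bz+c\end{pmatrix},\quad \mathcal F_{sm}(w)=\begin{pmatrix}\nabla f(y)\\ \nabla g(z)\\ 0\end{pmatrix},\quad \mathcal R=\mathcal R_{ns}+\mathcal F_{sm},$$ $$\mathcal M=\begin{pmatrix}\mathcal P_f+\sigma A^*A&0&A^*\\ 0&\mathcal P_g&0\\ A&0&\sigma^{-1}I\end{pmatrix}.$$ Under the stated hypotheses $\mathcal M\succeq0$ (possibly singular), so $\|w\|_{\mathcal M}=\langle w,\mathcal Mw\rangle^{1/2}$ is a seminorm. The KKT solution set is $\Omega^*:=\{w\in\mathbb H:0\in\mathcal R_{ns}(w)+\mathcal F_{sm}(w)\}$. **The mapping $\mathbf T=(\mathcal M+\mathcal R_{ns})^{-1}(\mathcal M-\mathcal F_{sm})$.** $\mathbf T(w)$ is the point $w^+\in\mathbb H$ with $\mathcal Mw-\mathcal F_{sm}(w)\in\mathcal Mw^++\mathcal R_{ns}(w^+)$; under the stated positive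 (semi)definiteness hypotheses such a $w^+$ exists and is unique for every $w\in\mathbb H$. **Halpern-accelerated majorized ADMM.** Given $w^0=(y^0,z^0,x^0)\in\mathbb H$ and $\lambda_k=\frac1{k+2}$, for $k=0,1,2,\dots$: 1. $\tilde z^{k+1}=\arg\min_z\{q(z)+\hat g(z,z^k)+\langle B^*x^k,z\rangle+\frac\sigma2\|Ay^k+Bz-c\|^2+\frac12\|z-z^k\|_{\mathcal T}^2\}$; 2. $\tilde x^{k+1}=x^k+\sigma(Ay^k+B\tilde z^{k+1}-c)$; 3. $\tilde y^{k+1}=\arg\min_y\{p(y)+\hat f(y,y^k)+\langle A^*\tilde x^{k+1},y\rangle+\frac\sigma2\|Ay+B\tilde z^{k+1}-c\|^2+\frac12\|y-y^k\|_{\mathcal S}^2\}$; 4. with $\widetilde w^{k+1}=(\tilde y^{k+1},\tilde z^{k+1},\tilde x^{k+1})$, $\widehat w^{k+1}=(1-\rho)w^k+\rho\widetilde w^{k+1}$; 5. $w^{k+1}=\lambda_kw^0+(1-\lambda_k)\widehat w^{k+1}$. Here $\widetilde w^{k+1}=\mathbf T(w^k)$, so the algorithm is the iteration $w^{k+1}=\lambda_kw^0+(1-\lambda_k)\bigl((1-\rho)w^k+\rho\mathbf T(w^k)\bigr)$. *)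

(* Defs.v *)
From HB Require Import structures.
From mathcomp Require Import all_boot all_order all_algebra.
From mathcomp Require Import all_classical all_reals all_analysis.

Set Implicit Arguments.
Unset Strict Implicit.
Unset Printing Implicit Defensive.

Import Order.TTheory GRing.Theory Num.Theory.
Import numFieldNormedType.Exports.

Local Open Scope classical_set_scope.
Local Open Scope ring_scope.

HB.mixin Record hasInner (R : realType) V & Vector R V := {
  inner : {dot V for (@idfun R)}
}.

#[short(type="innerType")]
HB.structure Definition InnerSpace (R : realType) :=
  {V of Vector R V & hasInner R V}.

Notation "''[' u , v ]" := (inner u v) : ring_scope.

Section InnerTheory.
Context {R : realType} (V : innerType R).
Implicit Types u v w : V.

Lemma innerC u v : '[u, v] = '[v, u].
Proof. by rewrite hermC expr0 mul1r. Qed.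

Lemma inner_gt0 u : u != 0 -> 0 < '[u, u].
Proof. exact: neq0_dnorm_gt0. Qed.

Lemma inner_ge0 u : 0 <= '[u, u].
Proof. by have [->|/inner_gt0/ltW//] := eqVneq u 0; rewrite linear0l. Qed.

Lemma inner_eq0 u : ('[u, u] == 0) = (u == 0).
Proof.
have [->|u0] := eqVneq u 0; first by rewrite linear0l eqxx.
by rewrite gt_eqF ?inner_gt0.
Qed.

Definition enorm u : R := Num.sqrt '[u, u].

End InnerTheory.

(* The normed-module structure provides the library's topology, differentials
   and Lipschitz maps; its norm has to be the one induced by [inner]. *)
HB.mixin Record InnerNormed_isEuclidean (R : realType) V
    & InnerSpace R V & NormedModule R V := {
  normE : forall u : V, `|u| = enorm u
}.

#[short(type="euclideanType")]
HB.structure Definition Euclidean (R : realType) :=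
  {V of InnerSpace R V & NormedModule R V & InnerNormed_isEuclidean R V}.

(* A product is only made an [innerType]: the library's norm on a pair is the
   maximum of the two norms, whereas [enorm] is the Euclidean product norm. *)
Section ProductInner.
Context {R : realType} (U V : innerType R).

Definition prod_inner (u v : U * V) : R := '[u.1, v.1] + '[u.2, v.2].

Let prod_inner_bilinear : bilinear_for *%R (idfun \; *%R) prod_inner.
Proof.
split=> [v a u u'|u a v v']; rewrite /prod_inner /=.
  by rewrite !linearPl /= mulrDr addrACA.
by rewrite !linearPr /= mulrDr addrACA.
Qed.

HB.instance Definition _ := bilinear_isBilinear.Build R (U * V)%type (U * V)%type
  R *%R (idfun \; *%R) prod_inner prod_inner_bilinear.

Let prod_inner_sym u v :
  prod_inner u v = (-1) ^+ false * idfun (prod_inner v u).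
Proof.
rewrite expr0 mul1r /prod_inner /=.
by congr (_ + _); exact: innerC.
Qed.

HB.instance Definition _ := isHermitianSesquilinear.Build R (U * V)%type
  false idfun prod_inner prod_inner_sym.

Let prod_inner_gt0 u : u != 0 -> 0 < prod_inner u u.
Proof.
case: u => a b; rewrite xpair_eqE negb_and /prod_inner /= => /orP[a0|b0].
  by rewrite ltr_wpDr ?inner_ge0 ?inner_gt0.
by rewrite ltr_wpDl ?inner_ge0 ?inner_gt0.
Qed.

HB.instance Definition _ := isDotProduct.Build R (U * V)%type prod_inner
  prod_inner_gt0.

HB.instance Definition _ := hasInner.Build R (U * V)%type prod_inner.

End ProductInner.

Section Riesz.
Context {R : realType} (V : innerType R).

Lemma riesz (phi : {linear V -> R^o}) : exists u, forall v, phi v = '[u, v] :> R.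
Proof.
pose L0 (u : V) : 'Hom(V, R^o) := linfun (inner u : V -> R^o).
have L0E u v : L0 u v = '[u, v] :> R.
  pose l := GRing.isLinear.Build R V R^o *:%R (inner u) (fun a x y => linearPr inner u a x y).
  pose F : {linear V -> R^o} := HB.pack (inner u : V -> R^o) l.
  exact: (lfunE F).
have L0lin : linear L0.
  by move=> a u u'; apply/lfunP => v; rewrite !lfunE /= !lfunE/= !L0E linearPl.
pose l := GRing.isLinear.Build R V 'Hom(V, R^o) *:%R L0 L0lin.
pose L := linfun (HB.pack L0 l : {linear V -> 'Hom(V, R^o)}).
have LE u v : L u v = '[u, v] :> R by rewrite lfunE /= L0E.
have kL : lker L == 0%VS.
  apply/lker0P => u u' e; apply/eqP; rewrite -subr_eq0 -inner_eq0 linearBl /=.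
  by rewrite -!LE e subrr.
have iL : limg L = fullv.
  apply/eqP; rewrite eqEdim subvf /=.
  by rewrite limg_dim_eq ?(eqP kL) ?capv0// !dimvf /= /dim /= muln1.
have : linfun phi \in limg L by rewrite iL memvf.
case/memv_imgP => u _ e; exists u => v.
by rewrite -LE -e lfunE.
Qed.

Lemma inner_ext (u v : V) : (forall w, '[u, w] = '[v, w]) -> u = v.
Proof.
move=> uv; apply/eqP; rewrite -subr_eq0 -inner_eq0 linearBl /=.
by rewrite uv subrr.
Qed.
End Riesz.

Section Operators.
Context {R : realType}.

Definition adjoint (V W : innerType R) (A : 'Hom(V, W)) : 'Hom(W, V) :=
  xget 0 [set B : 'Hom(W, V) | forall v w, '[A v, w] = '[v, B w]].

Lemma adjointP (V W : innerType R) (A : 'Hom(V, W)) v w :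
  '[A v, w] = '[v, adjoint A w].
Proof.
suff: exists B : 'Hom(W, V), forall v w, '[A v, w] = '[v, B w].
  by move=> /(xgetPex 0); exact.
have ex w' : exists u, forall v', '[A v', w'] = '[u, v'].
  have lin : linear (fun v' => '[A v', w'] : R^o).
    by move=> a x y; rewrite linearP linearPl.
  pose l := GRing.isLinear.Build R V R^o *:%R (fun v' => '[A v', w']) lin.
  exact: (riesz (HB.pack (fun v' => '[A v', w'] : R^o) l : {linear V -> R^o})).
have [B0 B0E] := choice ex.
have lin : linear B0.
  move=> a x y; apply: inner_ext => v'.
  by rewrite -B0E linearPr linearPl /= !B0E.
pose l := GRing.isLinear.Build R W V *:%R B0 lin.
exists (linfun (HB.pack B0 l : {linear W -> V})) => v' w'.
by rewrite lfunE /= B0E innerC.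
Qed.

Context (V : innerType R).
Implicit Types S D : 'End(V).

Definition self_adjoint S := forall u v, '[S u, v] = '[u, S v].

Definition psd S := forall v, 0 <= '[v, S v].
Definition pd S := forall v, v != 0 -> 0 < '[v, S v].

(* [qform S v] is ||v||_S^2, also for an indefinite S. *)
Definition qform S (v : V) : R := '[v, S v].
Definition seminorm S (v : V) : R := Num.sqrt (qform S v).

Definition op_norm S : R := sup [set enorm (S v) | v in [set v | enorm v <= 1]].

Definition penrose S D :=
  [/\ (S \o D \o S)%VF = S, (D \o S \o D)%VF = D,
      self_adjoint (S \o D)%VF & self_adjoint (D \o S)%VF].

Definition pseudoinv S : 'End(V) := xget 0 [set D : 'End(V) | penrose S D].

Lemma pseudoinvP S : self_adjoint S -> penrose S (pseudoinv S).
Proof.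
move=> sS.
suff: exists D, penrose S D by move=> /(xgetPex 0).
have I0 : (limg S :&: lker S)%VS = 0%VS.
  apply/eqP; rewrite -subv0; apply/subvP => v; rewrite memv_cap memv0.
  case/andP => /memv_imgP[u _ ->]; rewrite memv_ker => /eqP SSu.
  by rewrite -inner_eq0 sS SSu linear0r.
have IT : (limg S + lker S)%VS = fullv.
  apply/eqP; rewrite eqEdim subvf dimv_disjoint_sum//= addnC.
  by rewrite -(limg_ker_dim S fullv) capfv.
pose P := daddv_pi (limg S) (lker S); pose Q := daddv_pi (lker S) (limg S).
have PQ v : P v + Q v = v by apply: daddv_pi_add => //; rewrite IT memvf.
have SQ v : S (Q v) = 0 by apply/eqP; rewrite -memv_ker memv_pi.
have SP v : S (P v) = S v by rewrite -[in RHS](PQ v) linearD /= SQ addr0.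
have PI v : P v \in limg S by exact: memv_pi.
have PK v : S v = 0 -> P v = 0.
  move=> Sv; apply/eqP; rewrite -memv0 -I0 memv_cap PI /= memv_ker SP Sv//.
have PS v : P (S v) = S v by apply: daddv_pi_id => //; rewrite memv_img ?memvf.
pose D := (P \o S^-1 \o P)%VF.
have SD v : S (D v) = P v by rewrite !lfunE /= !lfunE /= SP limg_lfunVK.
have DS v : D (S v) = P v.
  rewrite !lfunE /= !lfunE /= PS; apply/eqP; rewrite -subr_eq0 -linearB /=.
  by apply/eqP/PK; rewrite linearB /= limg_lfunVK ?subrr// memv_img ?memvf.
have sP u v : '[P u, v] = '[u, P v].
  have K x y : '[P x, Q y] = 0.
    by have /memv_imgP[t _ ->] := PI x; rewrite sS SQ linear0r.
  rewrite -[in LHS](PQ v) -[in RHS](PQ u) linearDr linearDl /= K.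
  by rewrite [X in _ = _ + X]innerC K.
exists D; split.
- by apply/lfunP => v; rewrite !lfunE /= !lfunE /= SD PS.
- apply/lfunP => v; rewrite lfunE /= lfunE /= DS.
  by rewrite /D !lfunE /= !lfunE /= /P daddv_pi_proj.
- by move=> u v; rewrite !lfunE /= !SD sP.
- by move=> u v; rewrite !lfunE /= !DS sP.
Qed.

Definition dist0 (C : set V) : \bar R := ereal_inf [set (enorm r)%:E | r in C].

End Operators.

Section ConvexAnalysis.
Context {R : realType}.

Definition econvex (V : innerType R) (p : V -> \bar R) :=
  forall (x y : V) (t : R), 0 <= t <= 1 ->
    (p (t *: x + (1 - t) *: y)%R <= t%:E * p x + (1 - t)%R%:E * p y)%E.

Definition eproper (V : innerType R) (p : V -> \bar R) :=
  (forall x, p x != -oo%E) /\ (exists x, p x != +oo%E).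

Definition closed_proper_convex (V : euclideanType R) (p : V -> \bar R) :=
  [/\ lower_semicontinuous p, eproper p & econvex p].

Definition subdiff (V : innerType R) (p : V -> \bar R) (x : V) : set V :=
  [set v | forall y, (p x + '[v, (y - x)%R]%:E <= p y)%E].

Definition argmin (T : Type) (phi : T -> \bar R) : set T :=
  [set t | forall t', (phi t <= phi t')%E].

Definition grad (V : euclideanType R) (f : V -> R) (x : V) : V :=
  xget 0 [set v : V | forall h, 'd f x h = '[v, h] :> R].

Lemma gradP (V : euclideanType R) (f : V -> R) x h :
  'd f x h = '[grad f x, h] :> R.
Proof.
have [u uE] := riesz ('d f x : {linear V -> R^o}).
by have /(xgetPex 0) : exists v : V, forall h, 'd f x h = '[v, h] :> R by exists u.
Qed.

Definition convex_smooth (V : euclideanType R) (f : V -> R) :=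
  [/\ convex_function (setT : set (convex_lmodType V)) f,
      forall x, differentiable f x & exists L : R, L.-lipschitz (grad f)].

Definition majorant (V : euclideanType R) (f : V -> R) (S : 'End(V))
    (x x' : V) : R :=
  f x' + '[grad f x', x - x'] + 2^-1 * qform S (x - x').

End ConvexAnalysis.

(* (M + G)^-1 (M - F) for a set-valued G; 0 where the inclusion has no solution. *)
Definition fb_map (R : realType) (H : innerType R) (M : 'End(H))
    (G : H -> set H) (F : H -> H) (w : H) : H :=
  xget 0 [set w' : H | [set M w' + r | r in G w'] (M w - F w)].

Section ADMM.
Context {R : realType} {X Y Z : euclideanType R}.
Local Notation H := (Y * Z * X)%type.
Context (p : Y -> \bar R) (f : Y -> R) (q : Z -> \bar R) (g : Z -> R).
Context (A : 'Hom(Y, X)) (B : 'Hom(Z, X)) (c : X) (sigma : R).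

Definition Rns (w : H) : set H :=
  let: (y, z, x) := w in
  [set (v + adjoint A x, s + adjoint B x, - A y - B z + c)
    | v in subdiff p y & s in subdiff q z].

Definition Fsm (w : H) : H := let: (y, z, x) := w in (grad f y, grad g z, 0).

Definition KKTop (w : H) : set H := [set r + Fsm w | r in Rns w].

Definition KKTset : set H := [set w | KKTop w 0].

Definition Mfun (Pf : 'End(Y)) (Pg : 'End(Z)) (w : H) : H :=
  let: (y, z, x) := w in
  (Pf y + sigma *: adjoint A (A y) + adjoint A x, Pg z, A y + sigma^-1 *: x).

Lemma Mfun_linear Pf Pg : linear (Mfun Pf Pg).
Proof.
move=> a [[y z] x] [[y' z'] x']; rewrite /Mfun /=.
rewrite !linearP /=; congr (_, _, _) => /=; rewrite !scalerDr.
  by rewrite (addrACA (a *: Pf y)) (addrACA (a *: Pf y + _)).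
by rewrite addrACA.
Qed.

Definition Mop (Pf : 'End(Y)) (Pg : 'End(Z)) : 'End(H) := linfun (Mfun Pf Pg).

Lemma MopE Pf Pg : Mop Pf Pg =1 Mfun Pf Pg.
Proof.
pose L := GRing.isLinear.Build R H H *:%R (Mfun Pf Pg) (@Mfun_linear Pf Pg).
pose F : {linear H -> H} := HB.pack (Mfun Pf Pg) L.
exact: (lfunE F).
Qed.

Section Algorithm.
Context (Sf S : 'End(Y)) (Sg T : 'End(Z)) (rho : R).

Definition z_objective (w : H) (z : Z) : \bar R :=
  let: (yk, zk, xk) := w in
  (q z + (majorant g Sg z zk + '[adjoint B xk, z]
    + sigma / 2 * enorm (A yk + B z - c) ^+ 2
    + 2^-1 * qform T (z - zk))%R%:E)%E.

Definition y_objective (yk : Y) (tz : Z) (tx : X) (y : Y) : \bar R :=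
  (p y + (majorant f Sf y yk + '[adjoint A tx, y]
    + sigma / 2 * enorm (A y + B tz - c) ^+ 2
    + 2^-1 * qform S (y - yk))%R%:E)%E.

(* [wt k.+1] is the ADMM point computed from [w k]; [wt 0] is not used. *)
Definition halpern_admm (w wt : nat -> H) := forall k : nat,
  let: (yk, zk, xk) := w k in
  let: (ty, tz, tx) := wt k.+1 in
  let lambda : R := (k.+2)%:R^-1 in
  [/\ argmin (z_objective (w k)) tz,
      tx = xk + sigma *: (A yk + B tz - c),
      argmin (y_objective yk tz tx) ty
    & w k.+1 = lambda *: w 0%N
               + (1 - lambda) *: ((1 - rho) *: w k + rho *: wt k.+1)].

End Algorithm.
End ADMM.

(* Main.v *)
(* In the seminorm of [M], the map [T = (M + Rns)^-1 (M - Fsm)] composes a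
   firmly nonexpansive resolvent with the forward step [1 - M^+ Fsm], which is
   [beta]-averaged by cocoercivity; hence [T] is [(2 - beta)^-1]-averaged and its
   [rho]-relaxation [N] is nonexpansive. With [g k = (w k - N (w k)) / 2] the
   Halpern iteration makes
   [k (k+1) |g k|^2 + (k+1) <g k, w k - w 0>] nonincreasing (Lieder's rate), so
   [(k+1) |g k| <= |w 0 - ws|]. The residual [M (w - T w) - (Fsm w - Fsm (T w))]
   lies in [KKTop (T w)], and [|M v| <= |M|^(1/2) |v|_M] bounds it by
   [|w - T w|_M]. Although [M] may be singular, [T] is single-valued: two values
   differ by some [d] with [M d = 0], and monotonicity of the two
   subdifferentials separately then forces [A dy = B dz = 0]. *)
Require Import Defs.
From mathcomp Require Import all_boot all_order all_algebra.
From mathcomp Require Import all_classical all_reals all_analysis.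
From mathcomp Require Import ring lra.

Set Implicit Arguments.
Unset Strict Implicit.
Unset Printing Implicit Defensive.

Import Order.TTheory GRing.Theory Num.Theory.

Local Open Scope classical_set_scope.
Local Open Scope ring_scope.

(** * Linear maps, inner products and the seminorm of a semidefinite operator *)

Section Hom.
Context {R : realType} (V W : vectType R) (A : 'Hom(V, W)).
Implicit Types u v : V.

Lemma homD u v : A (u + v) = A u + A v. Proof. exact: (linearD A). Qed.
Lemma homN u : A (- u) = - A u. Proof. exact: (linearN A). Qed.
Lemma homZ a u : A (a *: u) = a *: A u. Proof. exact: (linearZ_LR A). Qed.
Lemma hom0 : A 0 = 0. Proof. exact: (linear0 A). Qed.

Definition homE := (homD, homN, homZ).
End Hom.

Section Inner.
Context {R : realType} (V : innerType R).
Implicit Types (u v x : V) (a : R).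

Lemma innerDl u v x : '[u + v, x] = '[u, x] + '[v, x].
Proof. exact: (linearDl inner). Qed.

Lemma innerDr x u v : '[x, u + v] = '[x, u] + '[x, v].
Proof. exact: (linearDr inner). Qed.

Lemma innerNl u x : '[- u, x] = - '[u, x].
Proof. exact: (linearNl inner). Qed.

Lemma innerNr x u : '[x, - u] = - '[x, u].
Proof. exact: (linearNr inner). Qed.

Lemma innerZl a u x : '[a *: u, x] = a * '[u, x].
Proof. exact: (linearZl_LR inner). Qed.

Lemma innerZr a x u : '[x, a *: u] = a * '[x, u].
Proof. exact: (linearZr_LR inner). Qed.

Lemma inner0l x : '[0, x] = 0.
Proof. exact: (linear0l inner). Qed.

Lemma inner0r x : '[x, 0] = 0.
Proof. exact: (linear0r inner). Qed.

Definition innerE := (innerDl, innerDr, innerNl, innerNr, innerZl, innerZr).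

Lemma enorm_ge0 u : 0 <= enorm u.
Proof. exact: sqrtr_ge0. Qed.

Lemma sqr_enorm u : enorm u ^+ 2 = '[u, u].
Proof. by rewrite sqr_sqrtr ?inner_ge0. Qed.

Lemma enorm_eq0 u : (enorm u == 0) = (u == 0).
Proof. by rewrite -sqrf_eq0 sqr_enorm inner_eq0. Qed.

Lemma enormZ a u : enorm (a *: u) = `|a| * enorm u.
Proof.
rewrite /enorm innerZl innerZr mulrA -expr2 sqrtrM ?sqr_ge0//.
by rewrite sqrtr_sqr.
Qed.

Section Psd.
Context (S : 'End(V)) (S_sym : self_adjoint S) (S_psd : psd S).

Lemma inner_selfC u v : '[u, S v] = '[v, S u].
Proof. by rewrite -S_sym innerC. Qed.

Lemma seminorm_ge0 u : 0 <= seminorm S u.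
Proof. exact: sqrtr_ge0. Qed.

Lemma sqr_seminorm u : seminorm S u ^+ 2 = '[u, S u].
Proof. exact/sqr_sqrtr/S_psd. Qed.

Lemma seminormZ a u : seminorm S (a *: u) = `|a| * seminorm S u.
Proof.
rewrite /seminorm /qform homZ innerZl innerZr mulrA -expr2.
by rewrite sqrtrM ?sqr_ge0// sqrtr_sqr.
Qed.

(** Nonnegativity of the form at [a *: u - b *: v], with the two seminorms crosswise as
    coefficients. As [S] may be singular, a vanishing seminorm needs its own [a] and [b], chosen so
    that a positive product would make the form negative. *)
Lemma CauchySchwarz_psd u v : '[u, S v] <= seminorm S u * seminorm S v.
Proof.
set s := seminorm S u; set t := seminorm S v.
have E a b : 0 <= a ^+ 2 * s ^+ 2 - 2 * a * b * '[u, S v] + b ^+ 2 * t ^+ 2.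
  have := S_psd (a *: u - b *: v).
  rewrite !homE !innerE (inner_selfC v u) -!sqr_seminorm -/s -/t.
  by congr (_ <= _); ring.
have [s0 t0] : 0 <= s /\ 0 <= t by split; exact: seminorm_ge0.
have [s0E|sN0] := eqVneq s 0; last first.
  have [tE|tN0] := eqVneq t 0.
    rewrite leNgt tE mulr0; apply/negP => c0; have := E '[u, S v] (s ^+ 2).
    rewrite tE; have : 0 < '[u, S v] ^+ 2 * s ^+ 2.
      by rewrite mulr_gt0 ?exprn_gt0// lt0r sN0.
    by lra.
  have := E t s; have : 0 < s * t by rewrite mulr_gt0// lt0r ?sN0 ?tN0.
  by nra.
rewrite leNgt s0E mul0r; apply/negP => c0; have := E ((t ^+ 2 + 1) / '[u, S v]) 1.
rewrite s0E mulr1 mulrA mulfVK ?gt_eqF// expr0n/= mulr0 add0r.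
by have := sqr_ge0 t; lra.
Qed.

End Psd.
End Inner.

(** * Euclidean norm, operator norm and their relation to the seminorm *)

Section OperatorNorm.
Context {R : realType} (V : innerType R).
Implicit Types (u v : V) (S : 'End(V)).

Lemma CauchySchwarz_inner u v : '[u, v] <= enorm u * enorm v.
Proof.
have I_sym : self_adjoint (\1%VF : 'End(V)) by move=> x y; rewrite !id_lfunE.
have I_psd : psd (\1%VF : 'End(V)) by move=> x; rewrite id_lfunE inner_ge0.
have := CauchySchwarz_psd I_sym I_psd u v.
by rewrite /seminorm /qform !id_lfunE.
Qed.

Lemma normr_inner u v : `|'[u, v]| <= enorm u * enorm v.
Proof.
rewrite ler_norml CauchySchwarz_inner andbT lerNl -innerNl.
have -> : enorm u = enorm (- u) by rewrite -scaleN1r enormZ normrN1 mul1r.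
exact: CauchySchwarz_inner.
Qed.

Lemma enormD u v : enorm (u + v) <= enorm u + enorm v.
Proof.
rewrite -(@ler_pXn2r _ 2%N) ?nnegrE ?addr_ge0 ?enorm_ge0//.
rewrite sqrrD !sqr_enorm !innerE (innerC v u).
by have := CauchySchwarz_inner u v; lra.
Qed.

Lemma enormB u v : enorm (u - v) <= enorm u + enorm v.
Proof.
by rewrite (le_trans (enormD _ _))// -scaleN1r enormZ normrN1 mul1r.
Qed.

Lemma enorm_sum n (F : 'I_n -> V) : enorm (\sum_i F i) <= \sum_i enorm (F i).
Proof.
elim/big_ind2: _ => //; first by rewrite /enorm inner0l sqrtr0.
by move=> x a y b xa yb; rewrite (le_trans (enormD _ _))// lerD.
Qed.

(** Expand [v] in a basis; by Riesz each coordinate is an inner product with a fixed vector. This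
    boundedness makes the supremum in [op_norm] a genuine one. *)
Lemma hom_bounded S : exists C, forall v, enorm (S v) <= C * enorm v.
Proof.
pose b := vbasis (fullv : {vspace V}).
have /choice[e eE] i : exists e, forall v, coord b i v = '[e, v].
  exact: (riesz (coord b i : {linear V -> R^o})).
exists (\sum_i enorm (e i) * enorm (S b`_i)) => v.
rewrite [in X in X <= _](coord_vbasis (memvf v)) linear_sum/=.
rewrite (le_trans (enorm_sum _))// mulr_suml ler_sum// => i _.
rewrite homZ enormZ mulrAC ler_wpM2r ?enorm_ge0//.
by rewrite eE normr_inner.
Qed.

Lemma op_norm_has_sup S : has_sup [set enorm (S v) | v in [set v | enorm v <= 1]].
Proof.
split; first by exists (enorm (S 0)), 0 => //=; rewrite /enorm inner0l sqrtr0.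
have [C SC] := hom_bounded S; exists `|C| => _ [v /= v1 <-].
rewrite (le_trans (SC v))// (le_trans (ler_norm _))// normrM ler_piMr//.
by rewrite ger0_norm ?enorm_ge0.
Qed.

Lemma op_norm_ge0 S : 0 <= op_norm S.
Proof.
apply: le_trans (enorm_ge0 (S 0)) _; apply: (ub_le_sup (op_norm_has_sup S).2).
by exists 0 => //=; rewrite /enorm inner0l sqrtr0.
Qed.

Lemma enorm_hom S v : enorm (S v) <= op_norm S * enorm v.
Proof.
have [->|v0] := eqVneq v 0; first by rewrite hom0 /enorm inner0l sqrtr0 mulr0.
have nv_gt0 : 0 < enorm v by rewrite lt0r enorm_ge0 enorm_eq0 v0.
rewrite -ler_pdivrMr// mulrC -[(enorm v)^-1]gtr0_norm ?invr_gt0//.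
rewrite -enormZ -homZ; apply: (ub_le_sup (op_norm_has_sup S).2).
exists ((enorm v)^-1 *: v) => //=.
by rewrite enormZ gtr0_norm ?invr_gt0// mulVf ?gt_eqF.
Qed.

(** Cauchy-Schwarz in the seminorm bounds |S v|^2 = <v, S (S v)> by |v|_S |S v|_S, and |S v|_S <=
    |S|^(1/2) |S v|; one factor |S v| cancels. *)
Lemma enorm_psd S v : self_adjoint S -> psd S ->
  enorm (S v) <= Num.sqrt (op_norm S) * seminorm S v.
Proof.
move=> S_sym S_psd.
have [Sv0|Sv0] := eqVneq (enorm (S v)) 0.
  by rewrite Sv0 mulr_ge0 ?sqrtr_ge0.
have Sv_gt0 : 0 < enorm (S v) by rewrite lt0r Sv0 enorm_ge0.
have nSv : seminorm S (S v) <= Num.sqrt (op_norm S) * enorm (S v).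
  rewrite -(@ler_pXn2r _ 2%N) ?nnegrE ?mulr_ge0 ?sqrtr_ge0//.
  rewrite sqr_seminorm// exprMn sqr_sqrtr ?op_norm_ge0//.
  rewrite (le_trans (CauchySchwarz_inner _ _))// expr2 mulrA mulrC.
  by rewrite ler_wpM2r ?enorm_ge0// enorm_hom.
rewrite -(ler_pM2r Sv_gt0) -expr2 sqr_enorm S_sym.
rewrite (le_trans (CauchySchwarz_psd S_sym S_psd _ _))//.
by rewrite mulrC mulrAC ler_wpM2r ?seminorm_ge0.
Qed.
End OperatorNorm.

(** * Monotone operators and the forward-backward step in the seminorm of [M] *)

Definition monotone_op (R : realType) (V : innerType R) (G : V -> set V) :=
  forall u v r s, G u r -> G v s -> 0 <= '[r - s, u - v].

Section ForwardBackward.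
Context {R : realType} (V : innerType R) (M : 'End(V)) (beta : R).
Context (M_sym : self_adjoint M) (M_psd : psd M) (beta_gt0 : 0 < beta).

Lemma pseudoinvK v : v \in limg M -> M (pseudoinv M v) = v.
Proof.
move=> /memv_imgP[u _ ->].
by have [/lfunP/(_ u) + _ _ _] := pseudoinvP M_sym; rewrite !lfunE/= lfunE.
Qed.

Lemma qform_pseudoinv v : v \in limg M ->
  qform (pseudoinv M) v = seminorm M (pseudoinv M v) ^+ 2.
Proof.
by move=> Mv; rewrite sqr_seminorm// pseudoinvK// innerC.
Qed.

(** Put e = M^+ v, so that M e = v. Cocoercivity and Cauchy-Schwarz give |e|_M^2 <= 2 beta |e|_M
    |d|_M; cancel |e|_M and apply [enorm_psd] to M e. *)
Lemma cocoercive_enorm v d : v \in limg M ->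
    (2 * beta)^-1 * qform (pseudoinv M) v <= '[v, d] ->
  enorm v <= 2 * beta * Num.sqrt (op_norm M) * seminorm M d.
Proof.
move=> Mv; rewrite qform_pseudoinv// mulrC ler_pdivrMr ?mulr_gt0// => vd.
have le_vd : seminorm M (pseudoinv M v) <= 2 * beta * seminorm M d.
  have [->|] := eqVneq (seminorm M (pseudoinv M v)) 0.
    by rewrite !mulr_ge0 ?sqrtr_ge0 ?(ltW beta_gt0).
  move=> s0; have s_gt0 : 0 < seminorm M (pseudoinv M v).
    by rewrite lt0r s0 seminorm_ge0.
  rewrite -(ler_pM2r s_gt0) -expr2 (le_trans vd)// mulrC -!mulrA.
  rewrite !ler_wpM2l ?(ltW beta_gt0)//.
  rewrite -[in '[v, d]](pseudoinvK Mv) M_sym mulrC.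
  exact: CauchySchwarz_psd.
rewrite -[v in enorm v](pseudoinvK Mv) (le_trans (enorm_psd _ M_sym M_psd))//.
by rewrite -mulrA mulrCA ler_wpM2l ?sqrtr_ge0// mulrA.
Qed.

Context (F : V -> V) (G : V -> set V).
Context (G_monotone : monotone_op G).
Context (F_coco : forall u v, F u - F v \in limg M /\
  (2 * beta)^-1 * qform (pseudoinv M) (F u - F v) <= '[F u - F v, u - v]).

(** The inclusion from which [fb_map] selects, kept as a relation so that the estimates below need
    neither existence nor uniqueness of a solution. *)
Definition fb_step (w t : V) := [set M t + r | r in G t] (M w - F w).

(** In the constant, 1 comes from M (w - t) through [enorm_psd] and 2 beta from F w - F t through
    [cocoercive_enorm]. *)
Lemma fb_residual w t : fb_step w t -> exists2 r, [set r + F t | r in G t] r &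
  enorm r <= (1 + 2 * beta) * Num.sqrt (op_norm M) * seminorm M (w - t).
Proof.
move=> [r Gr rE]; exists (r + F t); first by exists r.
have -> : r + F t = M (w - t) - (F w - F t).
  by apply: inner_ext => z; rewrite -[r](addKr (M t)) rE !homE !innerE; ring.
rewrite (le_trans (enormB _ _))// -mulrA mulrDl mul1r lerD ?enorm_psd// !mulrA.
by apply: cocoercive_enorm; case: (F_coco w t).
Qed.

(* In the seminorm of [M], [fb_step] is averaged with constant
   [(2 - beta)^-1], so its [rho]-relaxation is nonexpansive. *)
Lemma fb_firm rho w t w' t' : rho <= 2 - beta -> fb_step w t -> fb_step w' t' ->
  rho * seminorm M ((w - t) - (w' - t')) ^+ 2
    <= 2 * '[w - w', M ((w - t) - (w' - t'))].
Proof.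
move=> rho_le [r Gr rE] [r' Gr' rE'].
have [Mphi] := F_coco w w'; rewrite qform_pseudoinv//.
set phi := F w - F w' in Mphi *; set e := pseudoinv M phi => coco.
have phiE : phi = M e by rewrite pseudoinvK.
have := G_monotone Gr Gr'.
set a := (w - t) - (w' - t').
have -> : r - r' = M a - M e.
  rewrite -phiE /phi !homE -[r](addKr (M t)) rE -[r'](addKr (M t')) rE'.
  by apply: inner_ext => z; rewrite !innerE; ring.
have -> : t - t' = (w - w') - a.
  by apply: inner_ext => z; rewrite !innerE; ring.
move: coco; rewrite phiE M_sym mulrC ler_pdivrMr ?mulr_gt0//.
set d := w - w'; clearbody a d; rewrite !sqr_seminorm//.
(* Expanding |beta a - e|_M^2 >= 0 and bounding |e|_M^2 by cocoercivity controls the cross terms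
   left by monotonicity; after division by beta the loss is exactly beta |a|_M^2 out of 2
   |a|_M^2. *)
have := M_psd (beta *: a - e); have := M_psd a.
rewrite !homE !innerE !M_sym (inner_selfC M_sym d a) (inner_selfC M_sym e a).
move=> aa bae ee ade.
have : 0 <= beta * (beta * '[a, M a] - 2 * '[a, M e] + 2 * '[e, M d]) by lra.
rewrite pmulr_rge0//.
have : rho * '[a, M a] <= (2 - beta) * '[a, M a] by rewrite ler_wpM2r.
by lra.
Qed.
End ForwardBackward.

(** * Halpern iteration: potential and rate *)

Section Halpern.
Context {R : realType} (V : innerType R) (M : 'End(V)).
Context (M_sym : self_adjoint M) (M_psd : psd M).
Context (x g : nat -> V).
Context (x_rec : forall k, x k.+1 = (k.+2)%:R^-1 *: x 0%N
  + (1 - (k.+2)%:R^-1) *: (x k - 2 *: g k)).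
Context (g_firm : forall j k,
  seminorm M (g j - g k) ^+ 2 <= '[x j - x k, M (g j - g k)]).

(** Here [x k - 2 *: g k] is the image N (x k), and [g_firm] restates that N is nonexpansive along
    the iterates. The potential vanishes at 0, so it suffices that it never increases. *)
Lemma halpern_potential k :
  (k * k.+1)%:R * seminorm M (g k) ^+ 2 + k.+1%:R * '[x k - x 0%N, M (g k)] <= 0.
Proof.
elim: k => [|k IHk]; first by rewrite mul0n mul0r subrr inner0l mulr0 addr0.
apply: le_trans IHk; have := g_firm k.+1 k.
have -> : x k.+1 - x k = (x k.+1 - x 0%N) - (x k - x 0%N).
  by rewrite opprB addrA subrK.
have rec v : k.+2%:R * '[x k.+1 - x 0%N, M v]
    = k.+1%:R * ('[x k - x 0%N, M v] - 2 * '[g k, M v]).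
  have k0 : 1 + k%:R + 1 != 0 :> R by rewrite nat1r natr1 pnatr_eq0.
  by rewrite x_rec !innerE -(natr1 k.+1); field; exact: k0.
move: (rec (g k)) (rec (g k.+1)).
move: (x k.+1 - x 0%N) (x k - x 0%N) => D X.
rewrite !sqr_seminorm// !homE !innerE (inner_selfC M_sym (g k.+1) (g k)).
rewrite !natrM -(natr1 k.+1) -(natr1 k).
have : 0 <= k%:R :> R by exact: ler0n.
move: k%:R => n n0 E1 E2 firm.
(* With the weight (k+1)(k+2) on the firmness inequality, the products of [g k] with [g k.+1] cancel
   once the recursion is substituted. *)
have n12 : 0 <= (n + 1) * (n + 1 + 1) by nra.
have := ler_wpM2l n12 firm.
have := congr1 ( *%R (n + 1)) E1; have := congr1 ( *%R (n + 1 + 1)) E2.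
by lra.
Qed.

(** The hypothesis is firmness against a point [xs] where the residual vanishes. Added to the
    potential divided by k+1, it gives (k+1) |g k|^2 <= <x 0 - xs, M (g k)>, and Cauchy-Schwarz
    concludes. *)
Lemma halpern_rate xs k : seminorm M (g k) ^+ 2 <= '[x k - xs, M (g k)] ->
  k.+1%:R * seminorm M (g k) <= seminorm M (x 0%N - xs).
Proof.
move=> firm; have [->|g0] := eqVneq (seminorm M (g k)) 0.
  by rewrite mulr0 seminorm_ge0.
have g_gt0 : 0 < seminorm M (g k) by rewrite lt0r g0 seminorm_ge0.
rewrite -(ler_pM2r g_gt0).
apply: le_trans (CauchySchwarz_psd M_sym M_psd (x 0%N - xs) (g k)).
have := halpern_potential k.
rewrite (mulnC k) natrM -mulrA -mulrDr pmulr_rle0 ?ltr0n// => pot.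
have -> : k.+1%:R * seminorm M (g k) * seminorm M (g k)
  = k%:R * seminorm M (g k) ^+ 2 + seminorm M (g k) ^+ 2.
  by rewrite -natr1; ring.
have -> : x 0%N - xs = (x k - xs) - (x k - x 0%N).
  by apply: inner_ext => z; rewrite !innerE; ring.
by rewrite innerDl innerNl; lra.
Qed.
End Halpern.

(** * Convex subdifferentials and first-order optimality *)

Section Subdifferential.
Context {R : realType} (V : innerType R) (p : V -> \bar R).

(** [subdiff] does not ask for [p x] to be finite; the subgradient inequality at a point of finite
    value does. *)
Lemma subdiff_fin_num x v : eproper p -> subdiff p x v -> p x \is a fin_num.
Proof.
move=> [pNy [y0 py0]] /(_ y0) le_px; rewrite fin_numE pNy/=.
apply: contra_neq py0 => pxy; move: le_px; rewrite pxy addye//.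
by rewrite leye_eq => /eqP.
Qed.

Lemma subdiff_monotone : eproper p -> monotone_op (subdiff p).
Proof.
move=> p_proper u v r s ur vs; move: (ur v) (vs u).
rewrite -(fineK (subdiff_fin_num p_proper ur)).
rewrite -(fineK (subdiff_fin_num p_proper vs)) -!EFinD !lee_fin.
by rewrite !innerE; lra.
Qed.

(** Along each line through [t] the function [h] is quadratic with slope [d]. Comparing [t] with a
    point of the segment towards [y], convexity leaves an error s * K v after division by s,
    whatever the sign of K v. *)
Lemma argmin_subdiff (h K : V -> R) d t : eproper p -> econvex p ->
    argmin (fun v => (p v + (h v)%:E)%E) t ->
    (forall v s, h (t + s *: v) = h t + s * '[d, v] + s ^+ 2 * K v) ->
  subdiff p t (- d).
Proof.
move=> [pNy [y0 py0]] p_cvx t_min hE y.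
have pt_fin : p t \is a fin_num.
  rewrite fin_numE pNy/=; apply/eqP => pty; have := t_min y0; rewrite pty addye//.
  by rewrite leye_eq; move: (pNy y0) py0; case: (p y0).
have [py|py_fin] := eqVneq (p y) +oo%E; first by rewrite py leey.
have {}py_fin : p y \is a fin_num by rewrite fin_numE pNy.
rewrite -(fineK pt_fin) -(fineK py_fin) lee_fin.
set a := fine (p t); set b := fine (p y); set v := y - t.
have le_ab s : 0 < s <= 1 -> a <= b + '[d, v] + s * K v.
  move=> /andP[s_gt0 s_le1].
  have s01 : 0 <= s <= 1 by rewrite (ltW s_gt0).
  have vE : s *: y + (1 - s) *: t = t + s *: v.
    by rewrite scalerBr scalerBl scale1r addrC addrAC addrA.
  have := t_min (t + s *: v); rewrite -vE => t_le.
  have : (a%:E + (h t)%:E <=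
      (s * b + (1 - s) * a)%:E + (h (s *: y + (1 - s) *: t))%:E)%E.
    rewrite fineK//; apply: le_trans t_le _; apply: leeD2r.
    by rewrite EFinD !EFinM !fineK//; exact: p_cvx.
  rewrite -!EFinD lee_fin vE hE => le_h.
  by rewrite -(ler_pM2l s_gt0); move: le_h; rewrite expr2; lra.
rewrite innerNl leNgt; apply/negP => lt_ab.
(* At s = e / (e + |K v|) the inequality e <= s * K v becomes e + |K v| <= K v, which is absurd;
   this replaces the limit s -> 0. *)
pose e := a - b - '[d, v]; have e_gt0 : 0 < e by rewrite /e; lra.
have eK_gt0 : 0 < e + `|K v| by rewrite ltr_wpDr.
have := le_ab (e / (e + `|K v|)).
rewrite divr_gt0// ler_pdivrMr// mul1r lerDl normr_ge0 => /(_ isT).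
rewrite -lerBlDl opprD addrA -/e mulrAC ler_pdivlMr//.
rewrite ler_pM2l// => /le_trans/(_ (ler_norm _)).
by lra.
Qed.
End Subdifferential.

Lemma adjointE (R : realType) (V W : innerType R) (A : 'Hom(V, W)) v w :
  '[adjoint A w, v] = '[w, A v].
Proof. by rewrite innerC -adjointP innerC. Qed.

(** The common form of both ADMM subproblems: [a] carries the multiplier and [b] the fixed part of
    the constraint. *)
Lemma proximal_argmin (R : realType) (V : euclideanType R) (W : innerType R)
    (p : V -> \bar R) (f : V -> R) (Sf S : 'End(V)) (A : 'Hom(V, W))
    (b : W) (a v0 t : V) (sigma : R) :
    eproper p -> econvex p -> self_adjoint Sf -> self_adjoint S ->
    argmin (fun v => (p v + (majorant f Sf v v0 + '[a, v]
      + sigma / 2 * enorm (A v + b) ^+ 2 + 2^-1 * qform S (v - v0))%:E)%E) t ->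
  subdiff p t (- (grad f v0 + (S + Sf) (t - v0) + a
                  + sigma *: adjoint A (A t + b))).
Proof.
move=> p_proper p_cvx Sf_sym S_sym t_min.
apply: (argmin_subdiff (K := fun v => 2^-1 * qform Sf v
  + sigma / 2 * enorm (A v) ^+ 2 + 2^-1 * qform S v) p_proper p_cvx t_min).
move=> v s; rewrite /majorant [t + _ - _]addrAC; move: (t - v0) => d.
rewrite /qform !sqr_enorm add_lfunE !homE !innerE.
rewrite !adjointE (innerC _ (A v)) (innerC b) !Sf_sym !S_sym.
rewrite (inner_selfC Sf_sym v) (inner_selfC S_sym v).
rewrite (innerC (A v) b) (innerC (A v) (A t)).
by field.
Qed.

(** * The KKT operator, the metric [M] and the ADMM step *)

Section ADMM.
Context {R : realType} {X Y Z : euclideanType R}.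
Local Notation H := (Y * Z * X)%type.
Context (p : Y -> \bar R) (f : Y -> R) (q : Z -> \bar R) (g : Z -> R).
Context (A : 'Hom(Y, X)) (B : 'Hom(Z, X)) (c : X) (sigma : R).
Context (p_cpc : closed_proper_convex p) (q_cpc : closed_proper_convex q).
Context (sigma_gt0 : 0 < sigma).

Lemma inner_prod (U V : innerType R) (u v : U * V) :
  '[u, v] = '[u.1, v.1] + '[u.2, v.2].
Proof. by []. Qed.

(** The coupling through [A] and [B] is skew and cancels, leaving the two subdifferentials. *)
Lemma Rns_monotone : monotone_op (Rns p q A B c).
Proof.
move=> [[y z] x] [[y' z'] x'] r s [v pv [t qt <-]] [v' pv' [t' qt' <-]].
rewrite !inner_prod/=.
have [_ p_proper _] := p_cpc; have [_ q_proper _] := q_cpc.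
have := subdiff_monotone p_proper pv pv'.
have := subdiff_monotone q_proper qt qt'.
rewrite !innerE !adjointE -?adjointP.
rewrite !(innerC x) !(innerC x').
by lra.
Qed.

Section Metric.
Context (Pf : 'End(Y)) (Pg : 'End(Z)).
Context (Pf_sym : self_adjoint Pf) (Pg_sym : self_adjoint Pg).
Context (Pf_psd : psd Pf) (Pg_psd : psd Pg).
Local Notation M := (Mop A sigma Pf Pg).

Lemma Mop_self_adjoint : self_adjoint M.
Proof.
move=> [[y z] x] [[y' z'] x']; rewrite !MopE /Mfun !inner_prod/=.
rewrite !innerE Pf_sym Pg_sym !adjointE -?adjointP.
by rewrite (innerC x (A y')); ring.
Qed.

(** Completing the square in [sigma *: A y + x] makes semidefiniteness of [M] visible. *)
Lemma qform_Mop y z x : '[(y, z, x), M (y, z, x)] = '[y, Pf y] + '[z, Pg z]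
  + sigma^-1 * '[sigma *: A y + x, sigma *: A y + x].
Proof.
rewrite MopE /Mfun !inner_prod/= !innerE -!adjointP (innerC x).
by field; exact: lt0r_neq0.
Qed.

Lemma Mop_psd : psd M.
Proof.
move=> [[y z] x]; rewrite qform_Mop !addr_ge0//.
by rewrite mulr_ge0 ?inner_ge0// invr_ge0 ltW.
Qed.

Lemma fb_step_unique F w t t' :
    pd (Pf + sigma *: (adjoint A \o A)%VF) ->
    pd (Pg + sigma *: (adjoint B \o B)%VF) ->
  fb_step M F (Rns p q A B c) w t -> fb_step M F (Rns p q A B c) w t' -> t = t'.
Proof.
move=> pd_A pd_B [r Gr rE] [r' Gr' r'E].
have rr' : r - r' = - M (t - t').
  apply: inner_ext => v; rewrite -[r](addKr (M t)) rE -[r'](addKr (M t')) r'E.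
  by rewrite !homE !innerE; ring.
have M0 : M (t - t') = 0.
  apply/eqP; rewrite -enorm_eq0 eq_le enorm_ge0 andbT.
  rewrite (le_trans (enorm_psd _ Mop_self_adjoint Mop_psd))//.
  have q0 : '[t - t', M (t - t')] <= 0.
    by have := Rns_monotone Gr Gr'; rewrite rr' innerNl innerC oppr_ge0.
  by rewrite /seminorm /qform (ler0_sqrtr q0) mulr0.
(* As M (t - t') = 0, both inclusions use the same element of [Rns], so the subgradients differ only
   by the adjoint images of the multiplier difference. *)
move: rr'; rewrite M0 oppr0 => /eqP; rewrite subr_eq0 => /eqP rr'.
have [_ p_proper _] := p_cpc; have [_ q_proper _] := q_cpc.
move: t t' Gr Gr' M0 {rE r'E}.
move=> [[y z] x] [[y' z'] x'] [v pv [s qs vE]] [v' pv' [s' qs' vE']].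
rewrite -vE -vE' in rr'; case: rr' => e1 e2 e3 M0.
move: (subdiff_monotone p_proper pv pv') (subdiff_monotone q_proper qs qs').
have -> : v - v' = - adjoint A (x - x').
  apply: inner_ext => a; rewrite -[v](addrK (adjoint A x)) e1.
  by rewrite !homE !innerE; ring.
have -> : s - s' = - adjoint B (x - x').
  apply: inner_ext => a; rewrite -[s](addrK (adjoint B x)) e2.
  by rewrite !homE !innerE; ring.
have {e3} BA : B (z - z') = - A (y - y').
  apply: inner_ext => a; have := congr1 (inner^~ a) e3.
  by rewrite !homE !innerE; lra.
move=> pdy qdz; have {}M0 : M (y - y', z - z', x - x') = 0 by [].
suff [/subr0_eq-> /subr0_eq-> /subr0_eq->] :
  [/\ y - y' = 0, z - z' = 0 & x - x' = 0] by [].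
move: (y - y') (z - z') (x - x') BA M0 pdy qdz => dy dz dx BA.
rewrite MopE => -[M1 M2 M3]; rewrite !innerNl !adjointE BA innerNr => pdy qdz.
have dxE : dx = - sigma *: A dy.
  apply: inner_ext => a; have := congr1 (inner^~ a) M3.
  rewrite !innerE inner0l => /(congr1 ( *%R sigma)).
  by rewrite mulr0 mulrDr mulVKf ?gt_eqF//; lra.
(* Monotonicity in the z block reads 0 <= <dx, A dy>, which is - sigma |A dy|^2 by the third row of
   M d = 0. *)
have Ady : '[A dy, A dy] = 0.
  apply/eqP; rewrite eq_le inner_ge0 andbT -(pmulr_rle0 _ sigma_gt0).
  by move: qdz; rewrite dxE !innerE; lra.
have dy0 : dy = 0.
  apply/eqP/negPn/negP => /pd_A.
  have := congr1 (inner^~ dy) M1; rewrite add_lfunE scale_lfunE comp_lfunE.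
  rewrite !innerE !adjointE -!adjointP dxE !innerE Ady inner0l Pf_sym.
  by lra.
split=> //.
  apply/eqP/negPn/negP => /pd_B.
  rewrite add_lfunE scale_lfunE comp_lfunE M2 !innerE inner0r -adjointP BA.
  by rewrite dy0 hom0 oppr0 inner0l mulr0 addr0 ltxx.
by rewrite dxE dy0 hom0 scaler0.
Qed.
End Metric.

(** The y and z optimality conditions give the first two rows and the multiplier update the third.
    Substituting that update accounts for the penalty gradients, whose A y is the old iterate in the
    z-subproblem. *)
Lemma admm_fb_step (Sf S : 'End(Y)) (Sg T : 'End(Z)) rho w wt :
    self_adjoint Sf -> self_adjoint S -> self_adjoint Sg -> self_adjoint T ->
    halpern_admm p f q g A B c sigma Sf S Sg T rho w wt ->
  forall k, fb_step (Mop A sigma (S + Sf) (T + Sg)) (Fsm f g)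
    (Rns p q A B c) (w k) (wt k.+1).
Proof.
move=> Sf_sym S_sym Sg_sym T_sym + k => /(_ k).
case: (w k) => [[y z] x]; case: (wt k.+1) => [[ty tz] tx].
move=> [tz_min txE ty_min _].
have [_ p_proper p_cvx] := p_cpc; have [_ q_proper q_cvx] := q_cpc.
pose b := A y - c.
have {}tz_min : argmin (fun v => (q v + (majorant g Sg v z + '[adjoint B x, v]
    + sigma / 2 * enorm (B v + b) ^+ 2 + 2^-1 * qform T (v - z))%:E)%E) tz.
  move=> v; move: (tz_min v).
  by rewrite /z_objective /b ![A y + B _]addrC !addrA.
have {}ty_min : argmin (fun v => (p v + (majorant f Sf v y + '[adjoint A tx, v]
    + sigma / 2 * enorm (A v + (B tz - c)) ^+ 2
    + 2^-1 * qform S (v - y))%:E)%E) ty.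
  by move=> v; move: (ty_min v); rewrite /y_objective -!addrA.
have qs := proximal_argmin q_proper q_cvx Sg_sym T_sym tz_min.
have pv := proximal_argmin p_proper p_cvx Sf_sym S_sym ty_min.
eexists; first by eexists; [exact: pv|eexists; [exact: qs|reflexivity]].
rewrite !MopE /Mfun /Fsm /b {pv qs}; congr (_, _, _) => /=.
- by apply: inner_ext => v; rewrite txE !add_lfunE !homE !innerE; ring.
- by apply: inner_ext => v; rewrite txE !add_lfunE !homE !innerE; ring.
- apply: inner_ext => v; rewrite txE !innerE inner0l.
  by field; exact: lt0r_neq0.
Qed.
End ADMM.

(** * Residual bound and convergence rate of the accelerated method *)

Theorem corollary4p4 (R : realType) (X Y Z : euclideanType R)
    (p : Y -> \bar R) (q : Z -> \bar R) (f : Y -> R) (g : Z -> R)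
    (A : 'Hom(Y, X)) (B : 'Hom(Z, X)) (c : X)
    (Sf S : 'End(Y)) (Sg T : 'End(Z)) (sigma beta rho : R)
    (w wt : nat -> Y * Z * X) :
  let Pf := S + Sf in
  let Pg := T + Sg in
  let M := Mop A sigma Pf Pg in
  let F := Fsm f g in
  let Res := KKTop p f q g A B c in
  let Omega := KKTset p f q g A B c in
  let TT := fb_map M (Rns p q A B c) F in
  let u := fun k => TT (w k) in
  closed_proper_convex p -> closed_proper_convex q ->
  convex_smooth f -> convex_smooth g ->
  self_adjoint Sf -> psd Sf -> self_adjoint Sg -> psd Sg ->
  (forall y y', f y <= majorant f Sf y y') ->
  (forall z z', g z <= majorant g Sg z z') ->
  0 < sigma ->
  self_adjoint S -> self_adjoint T ->
  Omega !=set0 ->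
  psd Pf -> psd Pg ->
  pd (Pf + sigma *: (adjoint A \o A)%VF) ->
  pd (Pg + sigma *: (adjoint B \o B)%VF) ->
  0 < beta <= 1 ->
  (forall w1 w2, F w1 - F w2 \in limg M /\
    '[F w1 - F w2, w1 - w2] >= (2 * beta)^-1 * qform (pseudoinv M) (F w1 - F w2)) ->
  0 < rho <= 2 - beta ->
  halpern_admm p f q g A B c sigma Sf S Sg T rho w wt ->
  forall k : nat,
  [/\ u k = wt k.+1,
      exists2 r, Res (u k) r &
        enorm r <= (1 + 2 * beta) * Num.sqrt (op_norm M)
                   * seminorm M (w k - TT (w k))
    & forall ws, Omega ws ->
        (dist0 (Res (u k)) <=
          (2 * (1 + 2 * beta) * Num.sqrt (op_norm M) / (rho * k.+1%:R)
           * seminorm M (w 0%N - ws))%:E)%E].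
Proof.
move=> Pf Pg M F Res Omega TT u p_cpc q_cpc _ _ Sf_sym _ Sg_sym _ _ _ sigma_gt0.
move=> S_sym T_sym _ Pf_psd Pg_psd pd_A pd_B /andP[beta_gt0 _] F_coco.
move=> /andP[rho_gt0 rho_le] admm.
have Pf_sym : self_adjoint Pf.
  by move=> a b; rewrite !add_lfunE !innerE Sf_sym S_sym.
have Pg_sym : self_adjoint Pg.
  by move=> a b; rewrite !add_lfunE !innerE Sg_sym T_sym.
have M_sym : self_adjoint M by exact: Mop_self_adjoint.
have M_psd : psd M by exact: Mop_psd.
have G_mono := Rns_monotone (A := A) (B := B) (c := c) p_cpc q_cpc.
have step k : fb_step M F (Rns p q A B c) (w k) (wt k.+1).
  exact: (admm_fb_step p_cpc q_cpc sigma_gt0 Sf_sym S_sym Sg_sym T_sym admm).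
(* The ADMM point solves the inclusion, so [fb_map] does not fall back on its default 0, and
   uniqueness identifies the two points. *)
have TTE k : TT (w k) = wt k.+1.
  apply: xget_unique; first exact: step.
  move=> t t_step.
  exact: (fb_step_unique p_cpc q_cpc sigma_gt0 Pf_sym Pg_sym Pf_psd Pg_psd
    pd_A pd_B t_step (step k)).
move=> k; rewrite /u TTE.
have [r Rr r_le] := fb_residual M_sym M_psd beta_gt0 F_coco (step k).
split=> [//||ws]; first by exists r.
move=> [s Gs sF].
have ws_step : fb_step M F (Rns p q A B c) ws ws.
  by exists s => //; rewrite -[s](addrK (F ws)) [s + _]sF sub0r.
apply: (@le_trans _ _ (enorm r)%:E); first by apply: ereal_inf_lbound; exists r.
rewrite lee_fin (le_trans r_le)//.
(* This is (w - N w) / 2 for the relaxation N = (1 - rho) + rho T, so [w k - 2 *: g' k] is the point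
   that the Halpern step averages with [w 0]. Its firmness is [fb_firm] scaled by rho / 2. *)
pose g' k := (rho / 2) *: (w k - wt k.+1).
have rho2_ge0 : 0 <= rho / 2 by rewrite divr_ge0// ltW.
have rate : k.+1%:R * seminorm M (g' k) <= seminorm M (w 0%N - ws).
  apply: (halpern_rate M_sym M_psd (x := w) (g := g')).
  - move=> i; have -> : w i - 2 *: g' i = (1 - rho) *: w i + rho *: wt i.+1.
      by apply: inner_ext => v; rewrite /g' !innerE; field.
    have := admm i.
    by case: (w i) => [[? ?] ?]; case: (wt i.+1) => [[? ?] ?] [].
  - move=> i j; rewrite /g' -scalerBr seminormZ ger0_norm//.
    rewrite homZ innerZr exprMn expr2 -mulrA ler_wpM2l//.
    have := fb_firm M_sym M_psd beta_gt0 G_mono F_coco rho_le (step i) (step j).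
    by lra.
  (* A KKT point is a fixed point of T, so its own residual drops out of the firmness inequality. *)
  - rewrite /g' seminormZ ger0_norm//.
    rewrite homZ innerZr exprMn expr2 -mulrA ler_wpM2l//.
    have := fb_firm M_sym M_psd beta_gt0 G_mono F_coco rho_le (step k) ws_step.
    by rewrite subrr subr0; lra.
move: rate; rewrite seminormZ ger0_norm// => rate.
have -> : 2 * (1 + 2 * beta) * Num.sqrt (op_norm M) / (rho * k.+1%:R)
    * seminorm M (w 0%N - ws)
  = (1 + 2 * beta) * Num.sqrt (op_norm M)
    * (2 / (rho * k.+1%:R) * seminorm M (w 0%N - ws)) by ring.
rewrite ler_wpM2l ?mulr_ge0 ?sqrtr_ge0 ?addr_ge0 ?mulr_ge0 ?(ltW beta_gt0)//.
rewrite mulrAC ler_pdivlMr ?mulr_gt0 ?ltr0n//.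
by lra.
Qed.
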